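(* Let $\mathcal{X}\subseteq\mathbb{R}^m$ and $\mathcal{Y}\subseteq\mathbb{R}^n$ be nonempty polytopes and $A\in\mathbb{R}^{m\times n}$. There is a constant $\alpha>0$, depending only on the game $(A,\mathcal{X},\mathcal{Y})$ (in particular not on $\mu$), satisfying $$\max_{y\in\mathcal{Y}}x^\top Ay - v^\ast\ \ge\ \alpha\cdot\mathrm{dist}(x,\mathcal{X}^\ast)\quad\text{for all }x\in\mathcal{X},$$ and such that for every $\mu>0$ the (unique) minimax strategy $x^\mu$ of the asymmetrically perturbed game $\min_{x\in\mathcal{X}}\max_{y\in\mathcal{Y}}\{x^\top Ay+\frac{\mu}{2}\|x\|^2\}$ satisfies $$\mathrm{dist}(x^\mu,\mathcal{X}^\ast)\ \le\ 2\max\left\{0,\ \max_{x\in\mathcal{X}}\|x\|-\frac{\alpha}{\mu}\right\}.$$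
   Context: A polytope is a bounded polyhedron (compact). $\|\cdot\|$ is the Euclidean norm, and $\mathrm{dist}(a,S)=\min_{s\in S}\|a-s\|$ for a closed convex set $S$. The game value is $v^\ast=\min_{x\in\mathcal{X}}\max_{y\in\mathcal{Y}}x^\top Ay=\max_{y\in\mathcal{Y}}\min_{x\in\mathcal{X}}x^\top Ay$. The set of minimax strategies of the original game is $\mathcal{X}^\ast=\operatorname{argmin}_{x\in\mathcal{X}}\max_{y\in\mathcal{Y}}x^\top Ay$. The minimax strategy of the perturbed game is $x^\mu=\operatorname{argmin}_{x\in\mathcal{X}}\max_{y\in\mathcal{Y}}\{x^\top Ay+\frac{\mu}{2}\|x\|^2\}$, unique by strong convexity. *)

(* Defs.v *)
From mathcomp Require Import all_boot all_order all_algebra.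
From mathcomp Require Import all_classical all_reals all_analysis.
Set Implicit Arguments.
Unset Strict Implicit.
Unset Printing Implicit Defensive.
Import Order.TTheory GRing.Theory Num.Theory.
Import numFieldNormedType.Exports.
Local Open Scope classical_set_scope.
Local Open Scope ring_scope.

(* All maxima and minima below are over nonempty compact sets (or, for dist,
   over a nonempty closed set), where they are attained; they are written with
   the library's sup and inf on R, which coincide with max and min there. *)

Section Game.
Variable R : realType.

Definition polyhedron m (X : set 'cV[R]_m) : Prop :=
  exists (k : nat) (C : 'M[R]_(k, m)) (b : 'cV[R]_k),
    X = [set x | forall i : 'I_k, (C *m x) i 0 <= b i 0].

(* [bounded_set] refers to the library's sup norm on matrices, which is
   equivalent to the Euclidean norm. *)
Definition polytope m (X : set 'cV[R]_m) : Prop :=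
  polyhedron X /\ bounded_set X.

(* The library's norm `|x| on column vectors is the sup norm. *)
Definition enorm m (x : 'cV[R]_m) : R := Num.sqrt (\sum_(i < m) x i 0 ^+ 2).

Definition dist m (a : 'cV[R]_m) (S : set 'cV[R]_m) : R :=
  inf [set enorm (a - s) | s in S].

Definition argmin m (X : set 'cV[R]_m) (f : 'cV[R]_m -> R) : set 'cV[R]_m :=
  [set x | X x /\ forall x', X x' -> f x <= f x'].

Definition payoff m n (A : 'M[R]_(m, n)) (x : 'cV[R]_m) (y : 'cV[R]_n) : R :=
  (x^T *m A *m y) 0 0.

Definition max_payoff m n (A : 'M[R]_(m, n)) (Y : set 'cV[R]_n)
    (x : 'cV[R]_m) : R :=
  sup [set payoff A x y | y in Y].

Definition game_value m n (A : 'M[R]_(m, n)) (X : set 'cV[R]_m)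
    (Y : set 'cV[R]_n) : R :=
  inf [set max_payoff A Y x | x in X].

Definition minimax_strategies m n (A : 'M[R]_(m, n)) (X : set 'cV[R]_m)
    (Y : set 'cV[R]_n) : set 'cV[R]_m :=
  argmin X (max_payoff A Y).

Definition perturbed_max_payoff m n (A : 'M[R]_(m, n)) (Y : set 'cV[R]_n)
    (mu : R) (x : 'cV[R]_m) : R :=
  sup [set payoff A x y + mu / 2 * enorm x ^+ 2 | y in Y].

Definition perturbed_minimax_strategies m n (A : 'M[R]_(m, n))
    (X : set 'cV[R]_m) (Y : set 'cV[R]_n) (mu : R) : set 'cV[R]_m :=
  argmin X (perturbed_max_payoff A Y mu).

End Game.

(* Main.v *)
Require Import Defs.
From mathcomp Require Import all_boot all_order all_algebra.
From mathcomp Require Import all_classical all_reals all_analysis.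
From mathcomp Require Import lra.
Set Implicit Arguments.
Unset Strict Implicit.
Unset Printing Implicit Defensive.
Import Order.TTheory GRing.Theory Num.Theory.
Import numFieldNormedType.Exports.
Local Open Scope classical_set_scope.
Local Open Scope ring_scope.

(** The function f x = max_y x^T A y is convex and piecewise linear, so above
    its minimum v on X it grows at least linearly with the distance to the set
    X* of minimizers (a weak sharp minimum); this growth rate is alpha.  The
    quadratic term of the perturbed game can outweigh this growth only up to a
    distance that shrinks with mu, and not at all for small mu.

    Finitely many strategies of Y suffice to compute f
    ([polytope_finite_maximizers]): at a maximizer s of a linear form, only the
    constraints active at s matter, so any point chosen in advance on the face
    that they define is a maximizer too, and there are finitely many faces.
    Hence X* is cut out by finitely many linear inequalities, those of X and
    x^T A y_k <= v.

    The distance to a polyhedron is bounded by a multiple of the largest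
    violation of its inequalities ([hoffman_bound]).  If p is the point of the
    polyhedron closest to x, then x - p lies in the polar of the cone of
    directions w with <a_j, w> <= 0 for all j active at p.  No nonzero u of
    this polar cone lies in the cone itself, since that would give
    <u, u> <= 0; so some active a_j satisfies <a_j, u> > 0.  By compactness of
    the unit sphere the largest <a_j, u> is at least c |u| with c > 0, and c
    can be chosen independently of p because there are only finitely many
    active sets.  For x in X only the inequalities x^T A y_k <= v can be
    violated, and their violation is at most f x - v
    ([minimax_weak_sharp]).

    Let x be the perturbed minimizer, p the point of X* closest to it,
    e = |x - p| and M the largest norm on X.  Comparing the perturbed objective
    at x and at p gives
      alpha e <= f x - v <= mu/2 (|p|^2 - |x|^2)
              = mu/2 (2 <p, p - x> - e^2) <= mu/2 (2 M e - e^2),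
    hence e = 0 or e <= 2 (M - alpha / mu). *)

(** * The Euclidean inner product and norm *)

Section InnerProduct.
Variables (R : realType) (m : nat).
Implicit Types (u v w : 'cV[R]_m) (t : R).

Definition dot u v : R := (u^T *m v) 0 0.

Lemma dotE u v : dot u v = \sum_i u i 0 * v i 0.
Proof. by rewrite /dot mxE; apply: eq_bigr => i _; rewrite mxE. Qed.

Lemma dotC u v : dot u v = dot v u.
Proof. by rewrite !dotE; apply: eq_bigr => i _; rewrite mulrC. Qed.

Lemma dotDr u v w : dot u (v + w) = dot u v + dot u w.
Proof. by rewrite /dot mulmxDr mxE. Qed.

Lemma dotZr t u v : dot u (t *: v) = t * dot u v.
Proof. by rewrite /dot -scalemxAr mxE. Qed.

Lemma dotNr u v : dot u (- v) = - dot u v.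
Proof. by rewrite /dot mulmxN mxE. Qed.

Lemma dotDl u v w : dot (u + v) w = dot u w + dot v w.
Proof. by rewrite dotC dotDr !(dotC w). Qed.

Lemma dotZl t u v : dot (t *: u) v = t * dot u v.
Proof. by rewrite dotC dotZr dotC. Qed.

Lemma dotNl u v : dot (- u) v = - dot u v.
Proof. by rewrite dotC dotNr dotC. Qed.

Definition dot_linE := (dotDl, dotDr, dotNl, dotNr, dotZl, dotZr).

Lemma dotvv_ge0 u : 0 <= dot u u.
Proof. by rewrite dotE sumr_ge0 // => i _; rewrite -expr2 sqr_ge0. Qed.

Lemma enorm_ge0 u : 0 <= enorm u.
Proof. exact: sqrtr_ge0. Qed.

Lemma sqr_enorm u : enorm u ^+ 2 = dot u u.
Proof.
rewrite sqr_sqrtr; last by rewrite sumr_ge0 // => i _; rewrite sqr_ge0.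
by rewrite dotE; apply: eq_bigr.
Qed.

Lemma normr_coord_le_enorm u i : `|u i 0| <= enorm u.
Proof.
rewrite -sqrtr_sqr ler_wsqrtr// (bigD1 i)//= lerDl sumr_ge0// => j _.
exact: sqr_ge0.
Qed.

Lemma enorm0_eq0 u : enorm u = 0 -> u = 0.
Proof.
move=> u0; apply/matrixP => i j; rewrite ord1 mxE; apply/eqP.
by rewrite -normr_le0 -u0 normr_coord_le_enorm.
Qed.

Lemma enorm_gt0 u : u <> 0 -> 0 < enorm u.
Proof.
by move=> u0; rewrite lt0r enorm_ge0 andbT; apply/eqP => /enorm0_eq0.
Qed.

Lemma enorm0 : enorm (0 : 'cV[R]_m) = 0.
Proof. by apply/eqP; rewrite -sqrf_eq0 sqr_enorm -(scale0r 0) dotZl mul0r. Qed.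

Lemma enormZ t u : 0 <= t -> enorm (t *: u) = t * enorm u.
Proof.
move=> t0; apply/eqP; rewrite -(eqrXn2 (n := 2))// ?mulr_ge0 ?enorm_ge0//.
by rewrite exprMn !sqr_enorm !dot_linE mulrA.
Qed.

(** Cauchy-Schwarz, from the square of |v| u - |u| v being nonnegative. *)
Lemma dot_le_enorm u v : dot u v <= enorm u * enorm v.
Proof.
have [/enorm0_eq0 u0|u0] := eqVneq (enorm u) 0.
  by rewrite u0 enorm0 mul0r -(scale0r 0) dotZl mul0r.
have [/enorm0_eq0 v0|v0] := eqVneq (enorm v) 0.
  by rewrite v0 enorm0 mulr0 -(scale0r 0) dotZr mul0r.
have uv0 : 0 < enorm u * enorm v by rewrite mulr_gt0// lt0r ?u0 ?v0 enorm_ge0.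
have := dotvv_ge0 (enorm v *: u - enorm u *: v).
rewrite !dot_linE -!sqr_enorm (dotC v u) => h.
rewrite -(ler_pM2l uv0); nra.
Qed.

Lemma continuous_dot u : continuous (dot u).
Proof.
have -> : dot u = fun v => \sum_i u i 0 * v i 0.
  by apply/funext => v; exact: dotE.
apply: (@continuous_big R 'I_m +%R 0 xpredT).
  by move=> p; exact: pseudometric_normed_Zmodule.add_continuous.
move=> i _ v.
by apply: continuousM; [exact: cst_continuous|exact: coord_continuous].
Qed.

Lemma continuous_enorm : continuous (@enorm R m).
Proof.
move=> v; apply: continuous_comp; last exact: sqrt_continuous.
apply: (@continuous_big R 'I_m +%R 0 xpredT) v.
  by move=> p; exact: pseudometric_normed_Zmodule.add_continuous.
by move=> i _ v; apply: continuousM; exact: coord_continuous.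
Qed.

Lemma continuous_enorm_sub v : continuous (fun u => enorm (v - u)).
Proof.
move=> u; apply: (@continuous_comp _ _ _ (fun u => v - u) (@enorm R m)).
  by apply: continuousB; [exact: cst_continuous|exact: cvg_id].
exact: continuous_enorm.
Qed.

End InnerProduct.

(** * Compactness and attained extrema *)

Section Compactness.
Variables (R : realType) (m : nat).
Implicit Types S : set 'cV[R]_m.

Lemma normr_le_enorm (u : 'cV[R]_m) : `|u| <= enorm u.
Proof.
rewrite [leLHS]mx_normrE; apply: bigmax_le => [|[i j] _].
  exact: enorm_ge0.
by rewrite ord1 normr_coord_le_enorm.
Qed.

(** Boundedness refers to the sup norm, which the Euclidean norm dominates. *)
Lemma bounded_set_enorm S (M : R) :
  (forall s, S s -> enorm s <= M) -> bounded_set S.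
Proof.
move=> SM; exists M; split; first exact: num_real.
move=> N MN s /SM sM; apply: le_trans (normr_le_enorm s) _.
exact: le_trans sM (ltW MN).
Qed.

Lemma continuous_trmx : continuous (fun r : 'rV[R]_m => r^T : 'cV[R]_m).
Proof.
move=> r B [P nP PB]; exists (fun i j => P j i) => [i j|r' Pr'].
  by have := nP j i; rewrite mxE.
by apply: PB => i j; rewrite mxE; exact: Pr'.
Qed.

(** Transposition carries S to a set of row vectors, where the Heine-Borel
    theorem applies. *)
Lemma closed_bounded_argmin S (f : 'cV[R]_m -> R) : S !=set0 -> bounded_set S ->
  closed S -> continuous f -> argmin S f !=set0.
Proof.
move=> [s0 Ss0] bS cS cf.
pose tr (r : 'rV[R]_m) : 'cV[R]_m := r^T.
pose T := tr @^-1` S.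
have T0 : T !=set0 by exists s0^T; rewrite /T /tr /= trmxK.
have cT : compact T.
  apply: bounded_closed_compact.
    move: bS => [M [Mr bM]]; exists M; split => // N /bM bN r /bN.
    apply: le_trans; rewrite [leLHS]mx_normrE [leRHS]mx_normrE.
    apply: bigmax_le => [|[i j] _]; first exact: bigmax_ge_id.
    have -> : r i j = r^T j i by rewrite mxE.
    by apply: (le_bigmax _ (fun ij => `|r^T ij.1 ij.2|) (j, i)).
  by apply: preimage_closed => // r _; exact: continuous_trmx.
have cfT : {within T, continuous (f \o tr)}.
  apply: continuous_subspaceT => r; apply: continuous_comp.
    exact: continuous_trmx.
  exact: cf.
have [r] := compact_EVT_min T0 cT cfT.
rewrite inE => Tr rmin; exists r^T; split => // s Ss.
by have := rmin s^T; rewrite /= /tr trmxK; apply; rewrite inE /T /tr /= trmxK.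
Qed.

End Compactness.

Section Attained.
Variable R : realType.

Lemma sup_eq_max (E : set R) a : E a -> ubound E a -> sup E = a.
Proof.
move=> Ea aE; apply/eqP; rewrite eq_le ge_sup//=; last by exists a.
by apply: ub_le_sup => //; exists a.
Qed.

Lemma inf_eq_min (E : set R) a : E a -> lbound E a -> inf E = a.
Proof.
move=> Ea aE; apply/eqP; rewrite eq_le lb_le_inf//= ?andbT; last by exists a.
by apply: ge_inf => //; exists a.
Qed.

(** Every smallness requirement on a step length has this form; stated as a
    neighbourhood property, finitely many of them can be met at once. *)
Lemma near0_scale_le (s c : R) : 0 < s -> \forall t \near 0^'+, t * c <= s.
Proof.
move=> s0; have c0 : 0 < `|c| + 1 by rewrite ltr_wpDl.
near=> t; have t0 : 0 < t by near: t; exact: nbhs_right_gt.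
have : t <= s / (`|c| + 1).
  by near: t; apply: nbhs_right_ltW; rewrite divr_gt0.
rewrite ler_pdivlMr// => h; apply: le_trans h; rewrite ler_pM2l//.
by rewrite (le_trans (ler_norm c))// lerDl.
Unshelve. all: by end_near. Qed.

Lemma finite_pos_lower_bound (I : finType) (c : I -> R) :
  (forall i, 0 < c i) -> exists2 a, 0 < a & forall i, a <= c i.
Proof.
move=> c0.
have h : \forall t \near (0 : R)^'+, forall i, t * 1 <= c i.
  by apply: filter_forall => i; exact: near0_scale_le.
have : \forall t \near (0 : R)^'+, 0 < t /\ forall i, t * 1 <= c i.
  by apply: filterI => //; exact: nbhs_right_gt.
move=> /filter_ex [a [a0 ac]]; exists a => // i.
by rewrite -(mulr1 a).
Qed.

(** Near x all the l k vary by at most e, hence so does their maximum. *)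
Lemma continuous_finite_max (T : topologicalType) (K : finType)
    (l : K -> T -> R) (f : T -> R) :
  (forall k, continuous (l k)) -> (forall x k, l k x <= f x) ->
  (forall x, exists k, f x = l k x) -> continuous f.
Proof.
move=> cl lf fl x; apply/cvgrPdist_le => e e0.
have : \forall x' \near x, forall k, `|l k x - l k x'| <= e.
  by apply: filter_forall => k; move: (cl k x) => /cvgrPdist_le; exact.
apply: filterS => x' xx'; rewrite ler_distlC.
have [[k fk] [k' fk']] := (fl x, fl x').
have := lf x' k; have := lf x k'; move: (xx' k) (xx' k').
rewrite !ler_distlC fk fk' => /andP[? ?] /andP[? ?] ? ?.
by apply/andP; split; lra.
Qed.

End Attained.

(** * Polyhedra and the Hoffman bound *)

Section Polyhedron.
Variables (R : realType) (m : nat).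
Implicit Types (x p u w : 'cV[R]_m) (S : set 'cV[R]_m).

Definition halfspaces (J : finType) (a : J -> 'cV[R]_m) (b : J -> R) :=
  [set x | forall j, dot (a j) x <= b j].

Lemma polyhedronE S : polyhedron S ->
  exists k (a : 'I_k -> 'cV[R]_m) b, S = halfspaces a b.
Proof.
move=> [k [C [b ->]]]; exists k, (fun i => (row i C)^T), (fun i => b i 0).
have dot_row x i : dot (row i C)^T x = (C *m x) i 0.
  by rewrite /dot trmxK -row_mul [LHS]mxE.
by apply/seteqP; split => x Cx i; have := Cx i; rewrite dot_row.
Qed.

Lemma closed_halfspaces (J : finType) (a : J -> 'cV[R]_m) b :
  closed (halfspaces a b).
Proof.
rewrite (_ : halfspaces a b =
    \bigcap_(j in setT) (dot (a j) @^-1` [set r | r <= b j])).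
  apply: closed_bigI => j _; apply: preimage_closed; last exact: closed_le.
  by move=> x _; exact: continuous_dot.
by apply/seteqP; split => [x ax j _|x ax j]; [exact: ax|exact: (ax j I)].
Qed.

(** An inactive constraint has slack, hence survives a short step in any
    direction; so only the active ones restrict the directions one can take. *)
Lemma halfspaces_feasible_direction (J : finType) (a : J -> 'cV[R]_m) b p w :
  halfspaces a b p ->
  (forall j, dot (a j) p = b j -> dot (a j) w <= 0) ->
  \forall t \near 0^'+, halfspaces a b (p + t *: w).
Proof.
move=> ap aw; apply: filter_forall => j.
have [apj|apj] := eqVneq (dot (a j) p) (b j).
  near=> t; have t0 : 0 < t by near: t; exact: nbhs_right_gt.
  by rewrite dotDr dotZr -apj gerDl pmulr_rle0// aw.
have slack : 0 < b j - dot (a j) p by rewrite subr_gt0 lt_neqAle apj ap.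
near=> t; rewrite dotDr dotZr -lerBrDl.
by near: t; exact: near0_scale_le.
Unshelve. all: by end_near. Qed.

Lemma polytope_argmin S (f : 'cV[R]_m -> R) : S !=set0 -> polytope S ->
  continuous f -> argmin S f !=set0.
Proof.
move=> S0 [/polyhedronE[k [a [b Sab]]] bS]; apply: closed_bounded_argmin => //.
by rewrite Sab; exact: closed_halfspaces.
Qed.

(** A maximizer s of a linear form is in the relative interior of the face F
    given by its active constraints.  From s one can step away from any other
    point v of F without leaving S, which shows that v has at least the value
    of s.  One representative per set of constraints is therefore enough, and
    it need not be a vertex. *)
Lemma polytope_finite_maximizers S : S !=set0 -> polytope S ->
  exists (K : finType) (v : K -> 'cV[R]_m), (forall k, S (v k)) /\
    forall c, exists k, forall s, S s -> dot c s <= dot c (v k).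
Proof.
move=> S0 pS; have [[/polyhedronE[k [a [b Sab]]] _] [s0 Ss0]] := (pS, S0).
have face (I : {set 'I_k}) : exists v, S v /\
    ((exists s, S s /\ forall i, i \in I -> dot (a i) s = b i) ->
     forall i, i \in I -> dot (a i) v = b i).
  have [[s [Ss Is]]|noI] :=
    pselect (exists s, S s /\ forall i, i \in I -> dot (a i) s = b i).
    by exists s.
  by exists s0.
have [v vP] := choice face.
exists {set 'I_k}, v; split=> [I|c]; first by have [] := vP I.
have [|s [Ss smin]] := @polytope_argmin S (dot (- c)) S0 pS.
  exact: continuous_dot.
have smax s' : S s' -> dot c s' <= dot c s.
  by move=> /smin; rewrite !dotNl lerN2.
pose I := [set i | dot (a i) s == b i]%SET; exists I => s' /smax cs'.
have [SvI vI] := vP I.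
apply: le_trans cs' _.
have avI i : dot (a i) s = b i -> dot (a i) (v I) = b i.
  move=> ais; apply: vI; last by rewrite inE ais.
  by exists s; split => // j; rewrite inE => /eqP.
(* The step leads away from v I, and the constraints active at s are active at
   both points, so they stay active along it. *)
have : \forall t \near (0:R)^'+, 0 < t /\ halfspaces a b (s + t *: (s - v I)).
  apply: filterI; first exact: nbhs_right_gt.
  apply: halfspaces_feasible_direction; first by rewrite -Sab.
  by move=> i ais; rewrite dotDr dotNr avI// ais subrr.
move=> /filter_ex[t [t0]]; rewrite -Sab => /smax.
by rewrite dotDr dotZr gerDl pmulr_rle0// dotDr dotNr subr_le0.
Qed.

(** Moving from p by t w changes |x - p|^2 by -2 t <x - p, w> + t^2 |w|^2, which
    is negative for small t as soon as <x - p, w> > 0. *)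
Lemma closest_point_normal S x p w : argmin S (fun s => enorm (x - s)) p ->
  (\forall t \near 0^'+, S (p + t *: w)) -> dot (x - p) w <= 0.
Proof.
move=> [_ pmin] Sw; rewrite leNgt; apply/negP => xpw.
have : \forall t \near (0:R)^'+,
    [/\ 0 < t, t * dot w w <= dot (x - p) w & S (p + t *: w)].
  near=> t; split; near: t => //; first exact: nbhs_right_gt.
  exact: near0_scale_le.
move=> /filter_ex[t [t0 tw /pmin]].
rewrite opprD addrA; move: (x - p) xpw tw => y yw tw.
rewrite -(ler_sqr (enorm_ge0 _)) ?nnegrE ?enorm_ge0// !sqr_enorm.
rewrite !dot_linE (dotC w).
have := mulr_gt0 t0 yw.
have : t * (t * dot w w) <= t * dot y w by rewrite ler_pM2l.
by lra.
Unshelve. all: by end_near. Qed.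

(** The hypothesis on u says that u is in the polar of the cone of all w with
    <a_j, w> <= 0 for j in I.  A nonzero such u is outside that cone, as its
    membership would give <u, u> <= 0; so the largest <a_j, u> is positive, and
    it has a positive minimum over the unit vectors of the polar cone. *)
Lemma normal_cone_slope (J : finType) (a : J -> 'cV[R]_m) (I : {set J}) :
  exists c : R, 0 < c /\ forall u,
    (forall w, (forall j, j \in I -> dot (a j) w <= 0) -> dot u w <= 0) ->
    u <> 0 -> exists2 j, j \in I & c * enorm u <= dot (a j) u.
Proof.
pose C := [set w | forall j, j \in I -> dot (a j) w <= 0].
pose N := [set u | forall w, C w -> dot u w <= 0].
pose U := [set u | enorm u = 1] `&` N.
have normU u : N u -> u <> 0 -> U ((enorm u)^-1 *: u).
  move=> Nu u0; have e0 := enorm_gt0 u0; split.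
    by rewrite /= enormZ ?invr_ge0 ?ltW// mulVf ?gt_eqF.
  by move=> w wI; rewrite dotZl pmulr_rle0 ?invr_gt0// Nu.
have [U0|noU] := pselect (U !=set0); last first.
  exists 1; split => // u Nu u0; exfalso; apply: noU.
  by exists ((enorm u)^-1 *: u); exact: normU.
(* The default value 0 is harmless: only positive values of f matter. *)
pose f u := \big[Num.max/0]_(j in I) dot (a j) u.
have bU : bounded_set U.
  by apply: (@bounded_set_enorm _ _ _ 1) => u [/= -> _].
have cU : closed U.
  apply: closedI.
    apply: (@preimage_closed _ _ (@enorm R m) [set 1]); last exact: closed_eq.
    by move=> u _; exact: continuous_enorm.
  rewrite (_ : N = \bigcap_(w in C) (dot w @^-1` [set r | r <= 0])).
    apply: closed_bigI => w _; apply: preimage_closed; last exact: closed_le.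
    by move=> u _; exact: continuous_dot.
  apply/seteqP; split => u Nu w wC; last by rewrite dotC; exact: Nu.
  by rewrite /= dotC; exact: Nu.
have cf : continuous f.
  apply: (@continuous_big R J Num.max 0 (mem I)); first exact: max_continuous.
  by move=> j _; exact: continuous_dot.
have [u0 [[eu0 Nu0] u0min]] := closed_bounded_argmin U0 bU cU cf.
have c0 : 0 < f u0.
  rewrite ltNge; apply/negP => fu0.
  have /Nu0 : forall j, j \in I -> dot (a j) u0 <= 0.
    move=> j jI; apply: le_trans fu0.
    exact: (le_bigmax_cond _ (fun j => dot (a j) u0)).
  by rewrite -sqr_enorm eu0 expr1n ler10.
exists (f u0); split => // u Nu unz; have eu := enorm_gt0 unz.
apply: contrapT => noj.
have := u0min _ (normU u Nu unz); apply/negP; rewrite -ltNge.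
apply: bigmax_lt => // j jI; rewrite dotZr ltNge; apply/negP => h; apply: noj.
by exists j => //; rewrite -ler_pdivlMr// mulrC.
Qed.

(** Since [normal_cone_slope] knows the closest point only through its active
    set, the constant does not depend on the right-hand side b either. *)
Lemma hoffman_bound (J : finType) (a : J -> 'cV[R]_m) :
  exists2 c, 0 < c & forall b x p,
    argmin (halfspaces a b) (fun s => enorm (x - s)) p -> x <> p ->
    exists j, c * enorm (x - p) <= dot (a j) x - b j.
Proof.
have [slope slopeP] := choice (normal_cone_slope a).
have [c c0 cI] := finite_pos_lower_bound (fun I => (slopeP I).1).
exists c => // b x p px xp; have [ap _] := px.
pose I := [set j | dot (a j) p == b j]%SET.
have [||j jI ju] := (slopeP I).2 (x - p).
- move=> w wI; apply: closest_point_normal px _.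
  apply: halfspaces_feasible_direction => // j apj.
  by apply: wI; rewrite inE apj.
- by move=> /eqP; rewrite subr_eq0 => /eqP.
exists j; move: jI; rewrite inE => /eqP <-; rewrite -dotNr -dotDr.
by apply: le_trans ju; rewrite ler_wpM2r ?enorm_ge0// cI.
Qed.

End Polyhedron.

(** * The game and its perturbation *)

Section Game.
Variables (R : realType) (m n : nat) (A : 'M[R]_(m, n)).
Variables (X : set 'cV[R]_m) (Y : set 'cV[R]_n).
Hypotheses (X0 : X !=set0) (Y0 : Y !=set0).
Hypotheses (Xpoly : polytope X) (Ypoly : polytope Y).

Lemma payoff_dotl x y : payoff A x y = dot (A *m y) x.
Proof. by rewrite dotC /dot mulmxA. Qed.

Lemma payoff_dotr x y : payoff A x y = dot (A^T *m x) y.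
Proof. by rewrite /dot trmx_mul trmxK. Qed.

Lemma max_payoff_finite : exists (K : finType) (v : K -> 'cV[R]_n),
  (forall k, Y (v k)) /\ forall x, exists k,
    max_payoff A Y x = payoff A x (v k) /\
    forall y, Y y -> payoff A x y <= payoff A x (v k).
Proof.
have [K [v [Yv vmax]]] := polytope_finite_maximizers Y0 Ypoly.
exists K, v; split => // x; have [k kmax] := vmax (A^T *m x).
have ymax y : Y y -> payoff A x y <= payoff A x (v k).
  by move=> /kmax; rewrite !payoff_dotr.
exists k; split => //; apply: sup_eq_max; first by exists (v k).
by move=> _ [y Yy <-]; exact: ymax.
Qed.

Lemma payoff_le_max_payoff x y : Y y -> payoff A x y <= max_payoff A Y x.
Proof.
move=> Yy; have [K [v [_ /(_ x)[k [-> kmax]]]]] := max_payoff_finite.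
exact: kmax.
Qed.

Lemma max_payoff_attained x :
  exists2 y, Y y & max_payoff A Y x = payoff A x y.
Proof.
have [K [v [Yv /(_ x)[k [-> _]]]]] := max_payoff_finite.
by exists (v k).
Qed.

Lemma continuous_max_payoff : continuous (max_payoff A Y).
Proof.
have [K [v [Yv vP]]] := max_payoff_finite.
apply: (@continuous_finite_max _ _ K (fun k x => payoff A x (v k))).
- move=> k; rewrite (_ : (fun x => _) = dot (A *m v k)).
    exact: continuous_dot.
  by apply/funext => x; exact: payoff_dotl.
- by move=> x k; exact: payoff_le_max_payoff.
- by move=> x; have [k [-> _]] := vP x; exists k.
Qed.

(** The payoff of a best response at the midpoint is linear in x. *)
Lemma max_payoff_midpoint x x' :
  max_payoff A Y (2^-1 *: (x + x')) <=
    2^-1 * (max_payoff A Y x + max_payoff A Y x').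
Proof.
have [y Yy ->] := max_payoff_attained (2^-1 *: (x + x')).
have := payoff_le_max_payoff x Yy; have := payoff_le_max_payoff x' Yy.
by rewrite !payoff_dotl dotZr dotDr; lra.
Qed.

Lemma perturbed_max_payoffE mu x :
  perturbed_max_payoff A Y mu x = max_payoff A Y x + mu / 2 * enorm x ^+ 2.
Proof.
have [y Yy yx] := max_payoff_attained x.
apply: sup_eq_max; first by exists y => //; rewrite yx.
by move=> _ [y' Yy' <-]; rewrite lerD2r payoff_le_max_payoff.
Qed.

Lemma game_value_eq x : minimax_strategies A X Y x ->
  game_value A X Y = max_payoff A Y x.
Proof.
move=> [Xx xmin]; apply: inf_eq_min; first by exists x.
by move=> _ [x' Xx' <-]; exact: xmin.
Qed.

Lemma dist_closest_point (S : set 'cV[R]_m) a p :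
  argmin S (fun s => enorm (a - s)) p -> dist a S = enorm (a - p).
Proof.
move=> [Sp pmin]; apply: inf_eq_min; first by exists p.
by move=> _ [s Ss <-]; exact: pmin.
Qed.

(** For x in X the constraints of X hold, so the violated inequality that
    [hoffman_bound] provides is one of those comparing a payoff with the game
    value. *)
Lemma minimax_weak_sharp : exists2 alpha, 0 < alpha & forall x, X x ->
  exists2 p, argmin (minimax_strategies A X Y) (fun s => enorm (x - s)) p &
    alpha * enorm (x - p) <= max_payoff A Y x - game_value A X Y.
Proof.
have [x0 x0min] := polytope_argmin X0 Xpoly continuous_max_payoff.
have val := game_value_eq x0min.
have [K [v [Yv vP]]] := max_payoff_finite.
have [/polyhedronE[k [a [b Xab]]] bX] := Xpoly.
pose a' (j : 'I_k + K) := match j with inl i => a i | inr l => A *m v l end.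
pose b' (j : 'I_k + K) :=
  match j with inl i => b i | inr l => game_value A X Y end.
have optE : minimax_strategies A X Y = halfspaces a' b'.
  apply/seteqP; split => x.
    move=> xopt; have [Xx _] := xopt; move=> [i|l] /=.
      by move: Xx; rewrite Xab; exact.
    by rewrite -payoff_dotl (game_value_eq xopt) payoff_le_max_payoff.
  move=> xab; split=> [|x' Xx'].
    by rewrite Xab => i; exact: (xab (inl i)).
  apply: (@le_trans _ _ (game_value A X Y)).
    have [l [-> _]] := vP x; rewrite payoff_dotl.
    exact: (xab (inr l)).
  by rewrite val; case: x0min => _; exact.
have [c c0 cP] := hoffman_bound a'.
exists c => // x Xx.
have [||||p pclosest] := @closed_bounded_argmin _ _ (minimax_strategies A X Y)
    (fun s => enorm (x - s)).
- by exists x0.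
- by case: bX => M [Mr bM]; exists M; split => // N /bM bN s [Xs _]; exact: bN.
- by rewrite optE; exact: closed_halfspaces.
- exact: continuous_enorm_sub.
exists p => //; have [->|xp] := eqVneq x p.
  rewrite subrr enorm0 mulr0 subr_ge0 (game_value_eq (proj1 pclosest)) //.
have := pclosest; rewrite optE => /cP[|j]; first exact/eqP.
case: j => [i|l] /= h.
  have /enorm_gt0 e0 : x - p <> 0 by apply/eqP; rewrite subr_eq0.
  suff : c * enorm (x - p) <= 0 by rewrite leNgt mulr_gt0.
  by apply: le_trans h _; rewrite subr_le0; move: Xx; rewrite Xab; exact.
by apply: le_trans h _; rewrite lerD2r -payoff_dotl payoff_le_max_payoff.
Qed.

Lemma continuous_perturbed_max_payoff mu :
  continuous (perturbed_max_payoff A Y mu).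
Proof.
rewrite (_ : perturbed_max_payoff A Y mu =
    fun x => max_payoff A Y x + mu / 2 * (enorm x * enorm x)); last first.
  by apply/funext => x; rewrite perturbed_max_payoffE expr2.
move=> x; apply: continuousD; first exact: continuous_max_payoff.
apply: continuousM; first exact: cst_continuous.
by apply: continuousM; exact: continuous_enorm.
Qed.

Lemma polytope_midpoint x x' : X x -> X x' -> X (2^-1 *: (x + x')).
Proof.
have [/polyhedronE[k [a [b ->]]] _] := Xpoly.
move=> ax ax' i; rewrite dotZr dotDr; have := ax i; have := ax' i; lra.
Qed.

(** At the midpoint of two minimizers x and x' the quadratic term is smaller
    than the mean of its values by mu/8 |x - x'|^2, which must thus vanish. *)
Lemma perturbed_minimax_unique mu : 0 < mu ->
  exists x, perturbed_minimax_strategies A X Y mu = [set x].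
Proof.
move=> mu0.
have [x [Xx xmin]] :=
  polytope_argmin X0 Xpoly (@continuous_perturbed_max_payoff mu).
exists x; apply/seteqP; split => [x' [Xx' xmin']|_ ->//].
have := xmin _ (polytope_midpoint Xx Xx').
have := xmin' _ (polytope_midpoint Xx Xx').
have := max_payoff_midpoint x x'.
rewrite !perturbed_max_payoffE !sqr_enorm !dot_linE (dotC x' x) => h1 h2 h3.
apply/esym/eqP; rewrite -subr_eq0; apply/eqP/enorm0_eq0/eqP.
rewrite -sqrf_eq0 sqr_enorm eq_le dotvv_ge0 andbT -(pmulr_rle0 _ mu0).
rewrite !dot_linE (dotC x' x); lra.
Qed.

Lemma enorm_le_sup x : X x -> enorm x <= sup [set enorm x | x in X].
Proof.
move=> Xx; apply: ub_le_sup; last by exists x.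
have [|z [Xz zmax]] := @polytope_argmin _ _ X (fun x => - enorm x) X0 Xpoly.
  by move=> u; apply: continuousN; exact: continuous_enorm.
by exists (enorm z) => _ [u Xu <-]; rewrite -lerN2; exact: zmax.
Qed.

End Game.

Theorem theorem3p1 (R : realType) (m n : nat) (A : 'M[R]_(m, n))
    (X : set 'cV[R]_m) (Y : set 'cV[R]_n)
    (X0 : X !=set0) (Y0 : Y !=set0) (Xpoly : polytope X) (Ypoly : polytope Y) :
  exists alpha : R,
    [/\ 0 < alpha,
        forall x : 'cV[R]_m, X x ->
          max_payoff A Y x - game_value A X Y
            >= alpha * dist x (minimax_strategies A X Y)
      & forall mu : R, 0 < mu ->
          exists xmu : 'cV[R]_m,
            perturbed_minimax_strategies A X Y mu = [set xmu] /\
            dist xmu (minimax_strategies A X Y)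
              <= 2 * Num.max 0 (sup [set enorm x | x in X] - alpha / mu)].
Proof.
have [alpha alpha0 sharp] := minimax_weak_sharp A X0 Y0 Xpoly Ypoly.
exists alpha; split => // [x /sharp[p px]|mu mu0].
  by rewrite (dist_closest_point px).
have [x xE] := perturbed_minimax_unique A X0 Y0 Xpoly Ypoly mu0.
exists x; split => //.
have [Xx xmin] : perturbed_minimax_strategies A X Y mu x by rewrite xE.
have [p px sharp_x] := sharp x Xx.
have [popt _] := px; have [Xp _] := popt.
rewrite (dist_closest_point px).
set M := sup _; have pM : enorm p <= M := enorm_le_sup X0 Xpoly Xp.
have := xmin p Xp; rewrite !perturbed_max_payoffE//.
rewrite -(game_value_eq popt) => cmp.
have [->|e0] := eqVneq (enorm (x - p)) 0.
  by rewrite mulr_ge0// le_max lexx.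
have {}e0 : 0 < enorm (x - p) by rewrite lt0r e0 enorm_ge0.
apply: (@le_trans _ _ (2 * (M - alpha / mu))); last first.
  by rewrite ler_pM2l// le_max lexx orbT.
rewrite mulrBr lerBrDr.
(* |p|^2 - |x|^2 = 2 <p, p - x> - |x - p|^2, then Cauchy-Schwarz. *)
have cs : enorm p ^+ 2 - enorm x ^+ 2 <=
    enorm (x - p) * (2 * M - enorm (x - p)).
  have xp : enorm (p - x) = enorm (x - p).
    congr Num.sqrt; apply: eq_bigr => i _.
    by rewrite -sqrrN !mxE opprB.
  have := dot_le_enorm p (p - x); rewrite xp.
  have := ler_wpM2r (ltW e0) pM.
  have := sqr_enorm (x - p).
  rewrite expr2 !sqr_enorm !dot_linE (dotC x p); nra.
have : alpha * enorm (x - p) <=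
    mu / 2 * (2 * M - enorm (x - p)) * enorm (x - p).
  have : mu / 2 * (enorm p ^+ 2 - enorm x ^+ 2) <=
     mu / 2 * (enorm (x - p) * (2 * M - enorm (x - p))).
    by rewrite ler_pM2l// divr_gt0.
  by lra.
rewrite ler_pM2r// => h.
suff : alpha / mu <= M - enorm (x - p) / 2 by lra.
rewrite ler_pdivrMr//; lra.
Qed.
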